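(* Let $G$ be a finite simple graph on $n$ vertices and let $k=\lceil n/2\rceil$. If \[ \sigma_k(G)-\tau_k(G)\le\frac{2k+1-n}{k+1}, \] then $D(G,x)$ is unimodal with mode $k$, i.e. $d_0(G)\le\cdots\le d_k(G)\ge d_{k+1}(G)\ge\cdots\ge d_n(G)$.
   Context: A set $S\subseteq V(G)$ is dominating if every vertex of $G$ is in $S$ or adjacent to a vertex of $S$; $d_j(G)$ is the number of dominating sets of size $j$ and $D(G,x)=\sum_{j=0}^n d_j(G)x^j$. $N[v]$ is the closed neighborhood of $v$. Binomial coefficients $\binom{a}{k}$ are $0$ when $k>a$. Define $\sigma_k(G)=\sum_{v\in V(G)}\binom{n-|N[v]|}{k}\big/\binom{n}{k}$ and \[ \tau_k(G)=\max_T\sum_{uv\in E(T)}\frac{\binom{n-|N[u]\cup N[v]|}{k}}{\binom{n}{k}}, \] where the maximum ranges over all spanning trees $T$ of the complete graph on the vertex set $V(G)$ (edges of $T$ need not be edges of $G$). *)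

(* Defs.v *)
From mathcomp Require Import all_boot all_order all_algebra.
Set Implicit Arguments.
Unset Strict Implicit.
Unset Printing Implicit Defensive.
Import Order.TTheory GRing.Theory Num.Theory.
Local Open Scope ring_scope.

(* A finite simple graph is a symmetric irreflexive relation [e] on a finType
   of vertices; its order is [#|T|]. *)

Definition closed_nbhd (T : finType) (e : rel T) (v : T) : {set T} :=
  [set u | (u == v) || e v u].

Definition dominating (T : finType) (e : rel T) (S : {set T}) : bool :=
  [forall v, (v \in S) || [exists u in S, e v u]].

Definition dom_count (T : finType) (e : rel T) (j : nat) : nat :=
  #|[set S : {set T} | dominating e S & #|S| == j]|.

Definition dom_poly (T : finType) (e : rel T) : {poly int} :=
  \sum_(j < #|T|.+1) (dom_count e j)%:R *: 'X^j.

Definition unimodal_with_mode (p : {poly int}) (k : nat) : Prop :=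
  (forall j, (j < k)%N -> p`_j <= p`_j.+1) /\
  (forall j, (k <= j)%N -> (j.+1 < size p)%N -> p`_j.+1 <= p`_j).

(* Below, [F : {set {set T}}] is the edge set of a graph on [T], an edge being
   the 2-element set of its endpoints. *)

Definition edge_rel (T : finType) (F : {set {set T}}) : rel T :=
  [rel u v | [set u; v] \in F].

(* The vertices of a cycle are distinct, so bounding its length by [#|T|]
   loses nothing (see [acyclicP]). *)
Definition acyclic (T : finType) (F : {set {set T}}) : bool :=
  [forall m : 'I_#|T|.+1, forall c : m.-tuple T,
     (2 < m)%N ==> ~~ ucycleb (edge_rel F) c].

Definition spanning_tree (T : finType) (F : {set {set T}}) : bool :=
  [&& [forall a in F, #|a| == 2%N],
      [forall u, forall v, connect (edge_rel F) u v]
    & acyclic F].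

Lemma acyclicP (T : finType) (F : {set {set T}}) :
  reflect (forall c : seq T, (2 < size c)%N -> ~ ucycle (edge_rel F) c)
          (acyclic F).
Proof.
apply: (iffP forallP) => [acF c c_gt2 cyc | acF m].
  have sz_c : (size c < #|T|.+1)%N.
    by rewrite ltnS -(card_uniqP (ucycle_uniq cyc)) max_card.
  have /forallP/(_ (in_tuple c)) := acF (Ordinal sz_c).
  by rewrite /= c_gt2 => /negP.
apply/forallP => c; apply/implyP => m_gt2; apply/negP; apply: acF.
by rewrite size_tuple.
Qed.

Definition sigma (T : finType) (e : rel T) (k : nat) : rat :=
  \sum_(v : T) 'C(#|T| - #|closed_nbhd e v|, k)%:R / 'C(#|T|, k)%:R.

Definition tree_weight (T : finType) (e : rel T) (k : nat)
    (F : {set {set T}}) : rat :=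
  \sum_(a in F)
    'C(#|T| - #|\bigcup_(u in a) closed_nbhd e u|, k)%:R / 'C(#|T|, k)%:R.

(* Weights are nonnegative, so the default value 0 does not affect the
   maximum. *)
Definition tau (T : finType) (e : rel T) (k : nat) : rat :=
  \big[Order.max/0]_(F : {set {set T}} | spanning_tree F) tree_weight e k F.

(* Main.v *)
Require Import Defs.
From mathcomp Require Import all_boot all_order all_algebra.
From mathcomp Require Import zify lra.
Set Implicit Arguments.
Unset Strict Implicit.
Unset Printing Implicit Defensive.
Import Order.TTheory GRing.Theory Num.Theory.
Local Open Scope ring_scope.

(** Let [r_j = d_j / C(n, j)].  Dominating sets form an up-closed family, so
    [(n - j) d_j <= (j + 1) d_(j+1)]: hence [d_j <= d_(j+1)] when
    [2 j + 1 <= n], and [r_j] is nondecreasing.  A [k]-set [S] fails to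
    dominate iff the set [B] of vertices whose closed neighbourhood misses [S]
    is nonempty; a forest has fewer edges inside [B] than [B] has vertices, so
    summing over [S] gives the Hunter-Worsley bound
    [1 - r_k <= sigma_k - tau_k].  The hypothesis then reads
    [C(n, k+1) <= d_k], which propagates to [C(n, j+1) <= d_j] for all
    [j >= k], and [d_(j+1) <= C(n, j+1)]. *)

Section Forest.
Local Open Scope nat_scope.
Variables (T : finType) (F : {set {set T}}).

Lemma edge_rel_sym : symmetric (edge_rel F).
Proof. by move=> u v; rewrite /edge_rel /= setUC. Qed.

(** The end of a longest path inside [B] is such a vertex. Singletons are still allowed in [F] here
    and make [edge_rel F x x] true, hence the conditions [y != x] and [z != x]. *)
Lemma acyclic_leaf (B : {set T}) : acyclic F -> B != set0 ->
  exists2 x, x \in B & forall y z, y \in B -> z \in B -> y != x -> z != x ->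
    edge_rel F x y -> edge_rel F x z -> y = z.
Proof.
move=> /acyclicP acF /set0Pn[x0 x0B].
pose P m := [exists c : m.-tuple T,
  [&& 0 < m, uniq c, all (mem B) c & sorted (edge_rel F) c]].
have exP : exists m, P m.
  by exists 1; apply/existsP; exists [tuple x0]; rewrite /= x0B.
have ubP m : P m -> m <= #|T|.
  by case/existsP=> c /and4P[_ /card_uniqP uc _ _]; rewrite -(size_tuple c) -uc max_card.
have [m /existsP[c /and4P[m_gt0 uc cB pc]] maxm] := ex_maxnP exP ubP.
have := size_tuple c.
case: (tval c) uc cB pc => [|x p]; first by move=> _ _ _ /= m0; rewrite -m0 in m_gt0.
move=> ux xpB pxp szm; exists x; first by case/andP: xpB.
(* A neighbour of the end [x] of a longest path must be next to [x] on it: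
   otherwise it would extend the path or close a cycle. *)
have next y : y \in B -> y != x -> edge_rel F x y -> exists q, p = y :: q.
  move=> yB yx xy.
  have yp : y \in p.
    apply: contraT => ynp; suff /maxm : P m.+1 by rewrite ltnn.
    have sz : size (y :: x :: p) == m.+1 by rewrite -szm.
    apply/existsP; exists (Tuple sz); apply/and4P; split=> //.
    - by rewrite cons_uniq inE negb_or yx ynp.
    - by rewrite /= yB.
    - by rewrite /= edge_rel_sym xy.
  case/splitPr: yp ux pxp => -[|z q1] q2 ux pxp; first by exists q2.
  case: (acF (x :: z :: rcons q1 y)); first by rewrite /= size_rcons.
  apply/andP; split.
    rewrite /cycle -rcons_cons rcons_path last_rcons edge_rel_sym xy andbT.
    by move: pxp; rewrite /sorted -cat_rcons cat_path => /andP[].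
  by move: ux; rewrite -cat_rcons -cat_cons cat_uniq => /andP[].
move=> y z yB zB yx zx /(next _ yB yx)[q pq] /(next _ zB zx)[q2 pq2].
by move: pq2; rewrite pq => -[].
Qed.

(** Induction on [#|B|]: deleting a leaf [x] of [B] destroys at most one edge inside [B]. *)
Lemma acyclic_card (B : {set T}) :
  (forall a, a \in F -> #|a| = 2) -> acyclic F -> B != set0 ->
  #|[set a in F | a \subset B]| < #|B|.
Proof.
move=> F2 acF; have [m] := ubnP #|B|; elim: m B => // m IHm B ltBm B0.
have [x xB leaf] := acyclic_leaf acF B0.
rewrite [#|B|](cardsD1 x) xB add1n ltnS in ltBm *.
have other a : a \in F -> a \subset B -> x \in a ->
    exists y, [/\ y \in B, y != x, edge_rel F x y & a = [set x; y]].
  move=> aF aB xa; have /eqP/cards2P[u [v [uv a_uv]]] := F2 _ aF.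
  move: aF aB xa; rewrite a_uv => aF.
  rewrite subUset !sub1set => /andP[uB vB]; rewrite !inE => /orP[] /eqP xE.
    by exists v; rewrite xE eq_sym.
  by exists u; rewrite xE uv uB /edge_rel /= setUC.
have le1 : #|[set a in F | (a \subset B) && (x \in a)]| <= 1.
  apply/card_le1_eqP => a b; rewrite !inE.
  move=> /and3P[aF aB xa] /and3P[bF bB xb].
  have [y [yB yx xy ->]] := other a aF aB xa.
  have [z [zB zx xz ->]] := other b bF bB xb.
  by rewrite (leaf y z).
have split_x : [set a in F | a \subset B] \subset
    [set a in F | a \subset B :\ x] :|:
    [set a in F | (a \subset B) && (x \in a)].
  by apply/subsetP => a; rewrite !inE subsetD1 => /andP[-> ->] /=; case: (x \in a).
apply: leq_trans (subset_leq_card split_x) _.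
apply: leq_trans (leq_card_setU _ _) _.
have [B1 | /(IHm _ ltBm) IHB] := eqVneq (B :\ x) set0; last first.
  by apply: leq_trans (leq_add (leqnn _) le1) _; rewrite addn1.
rewrite B1 cards0 leqn0 addn_eq0 !cards_eq0; apply/andP; split; apply/eqP/setP=> a.
  rewrite !inE subset0; apply/negP => /andP[/F2 a2 /eqP a0].
  by rewrite a0 cards0 in a2.
rewrite !inE; apply/negP => /and3P[aF aB xa].
have [y [yB yx _ _]] := other a aF aB xa.
by move/setP/(_ y): B1; rewrite !inE yx yB.
Qed.

End Forest.

Section DominatingSets.
Local Open Scope nat_scope.
Variables (T : finType) (e : rel T).

Lemma dominatingS (S S' : {set T}) :
  S \subset S' -> dominating e S -> dominating e S'.
Proof.
move=> /subsetP sSS' /forallP dS; apply/forallP => v.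
have /orP[/sSS' -> // | /exists_inP[u /sSS' uS' evu]] := dS v.
by apply/orP; right; apply/exists_inP; exists u.
Qed.

Lemma dom_count_le_bin j : dom_count e j <= 'C(#|T|, j).
Proof.
rewrite -cardsT -cards_draws; apply/subset_leq_card/subsetP => S.
by rewrite !inE subsetT => /andP[].
Qed.

(** Double counting: [(S, x)] with [x] outside [S] goes to [(x |: S, x)]. This map is injective,
    since removing [x] recovers [S], and it preserves domination. *)
Lemma dom_count_local_LYM j :
  (#|T| - j) * dom_count e j <= j.+1 * dom_count e j.+1.
Proof.
pose A i := [set S : {set T} | dominating e S & #|S| == i].
pose X := [set p : {set T} * T | (p.1 \in A j) && (p.2 \notin p.1)].
pose Y := [set p : {set T} * T | (p.1 \in A j.+1) && (p.2 \in p.1)].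
have cardX : #|X| = (#|T| - j) * dom_count e j.
  rewrite -sum1dep_card -(pair_big_dep (mem (A j)) (fun S x => x \notin S) (fun _ _ => 1)) /=.
  rewrite mulnC -sum_nat_const; apply: eq_bigr => S; rewrite inE => /andP[_ /eqP Sj].
  by rewrite sum1dep_card -Sj -(cardsC S) addKn; apply: eq_card => x; rewrite !inE.
have cardY : #|Y| = j.+1 * dom_count e j.+1.
  rewrite -sum1dep_card -(pair_big_dep (mem (A j.+1)) (fun S x => x \in S) (fun _ _ => 1)) /=.
  rewrite mulnC -sum_nat_const; apply: eq_bigr => S; rewrite inE => /andP[_ /eqP Sj].
  by rewrite sum1_card.
pose f (p : {set T} * T) := (p.2 |: p.1, p.2).
rewrite -cardX -cardY -(card_in_imset (f := f)).
  apply/subset_leq_card/subsetP => _ /imsetP[[S x] + ->].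
  rewrite !inE /= => /andP[/andP[dS /eqP Sj] xS].
  rewrite cardsU1 xS Sj eqxx eqxx !andbT.
  exact: dominatingS (subsetUr _ _) dS.
move=> [S x] [S' x']; rewrite !inE /= => /andP[_ xS] /andP[_ xS'] [eqU eqx].
rewrite -eqx in xS' eqU *; congr (_, _).
by rewrite -(setU1K xS) -(setU1K xS') eqU.
Qed.

Lemma dom_count_le_incr j :
  j.*2 < #|T| -> dom_count e j <= dom_count e j.+1.
Proof.
move=> ltj; rewrite -(leq_pmul2l (ltn0Sn j)).
by apply: leq_trans (dom_count_local_LYM j); rewrite leq_mul2r; apply/orP; right; lia.
Qed.

Lemma bin_le_dom_count k j :
  'C(#|T|, k.+1) <= dom_count e k -> k <= j ->
  'C(#|T|, j.+1) <= dom_count e j.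
Proof.
move=> base; elim: j => [|j IHj]; first by rewrite leqn0 => /eqP <-.
rewrite leq_eqVlt => /predU1P[<- // |]; rewrite ltnS => /IHj {}IHj.
have [nj|jn] := leqP #|T| j.+1; first by rewrite bin_small.
rewrite -(leq_pmul2l (ltn0Sn j)); apply: leq_trans (dom_count_local_LYM j).
apply: leq_trans (leq_mul (leqnn _) IHj).
(* The factor [j.+2] lets [mul_bin_left] turn ['C(#|T|, j.+2)] into ['C(#|T|, j.+1)]; what is left
   is [j.+1 * (#|T| - j.+1) <= j.+2 * (#|T| - j)]. *)
rewrite -(leq_pmul2l (ltn0Sn j.+1)) mulnCA mul_bin_left !mulnA leq_mul2r.
by apply/orP; right; nia.
Qed.

(** The set [B] of undominated vertices from the overview, phrased by inclusion in a complement so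
    that [cards_draws] can count the sets [S]. *)
Definition missed (S : {set T}) : {set T} :=
  [set v | S \subset ~: closed_nbhd e v].

Lemma dominating_missed (S : {set T}) : dominating e S = (missed S == set0).
Proof.
apply/idP/eqP => [/forallP dS | m0].
  apply/setP => v; rewrite !inE; apply/negP => /subsetP sSv.
  have /orP[/sSv | /exists_inP[u /sSv]] := dS v; rewrite !inE ?eqxx //.
  by move=> /norP[_ /negPf->].
apply/forallP => v; move/setP/(_ v): m0; rewrite !inE => /negbT/subsetPn[u uS].
rewrite !inE negbK => /predU1P[<- | evu]; first by rewrite uS.
by apply/orP; right; apply/exists_inP; exists u.
Qed.

(** Identifies the edge terms of [tree_weight], once summed over [S], as counts of edges inside
    [missed S]. *)
Lemma subset_missed (S a : {set T}) :
  (a \subset missed S) = (S \subset ~: \bigcup_(u in a) closed_nbhd e u).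
Proof.
rewrite -disjoints_subset disjoint_sym disjoints_subset.
apply/subsetP/bigcupsP => sub u /sub; rewrite inE.
  by rewrite -disjoints_subset disjoint_sym disjoints_subset.
by rewrite -disjoints_subset disjoint_sym disjoints_subset.
Qed.

Lemma card_ksubsets_avoiding (A : {set T}) k :
  'C(#|T| - #|A|, k) = \sum_(S : {set T} | #|S| == k) (S \subset ~: A).
Proof.
rewrite -(cardsC A) addKn -cards_draws -sum1dep_card [RHS]big_mkcond /= big_mkcond.
by apply: eq_bigr => S _; rewrite andbC; case: (#|S| == k); case: (S \subset _).
Qed.

Lemma hunter_worsley_bound (F : {set {set T}}) k :
  (forall a, a \in F -> #|a| = 2) -> acyclic F ->
  'C(#|T|, k) + \sum_(a in F) 'C(#|T| - #|\bigcup_(u in a) closed_nbhd e u|, k)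
    <= dom_count e k + \sum_(v : T) 'C(#|T| - #|closed_nbhd e v|, k).
Proof.
move=> F2 acF.
have -> : 'C(#|T|, k) = \sum_(S : {set T} | #|S| == k) 1.
  by rewrite -cardsT -cards_draws sum1dep_card; apply: eq_card => S; rewrite !inE subsetT.
have -> : dom_count e k = \sum_(S : {set T} | #|S| == k) (dominating e S).
  rewrite /dom_count -sum1dep_card [RHS]big_mkcond /= big_mkcond.
  by apply: eq_bigr => S _; case: (dominating e S); case: (#|S| == k).
under [X in _ + X <= _]eq_bigr => a _ do rewrite card_ksubsets_avoiding.
under [X in _ <= _ + X]eq_bigr => v _ do rewrite card_ksubsets_avoiding.
rewrite exchange_big [X in _ <= _ + X]exchange_big -!big_split /=.
(* For each [S], one plus the number of edges inside [missed S] is to be bounded by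
   [dominating e S + #|missed S|]. *)
apply: leq_sum => S _.
have -> : \sum_(v : T) (S \subset ~: closed_nbhd e v) = #|missed S|.
  by rewrite -sum1dep_card [RHS]big_mkcond.
have -> : \sum_(a in F) (S \subset ~: \bigcup_(u in a) closed_nbhd e u)
    = #|[set a in F | a \subset missed S]|.
  rewrite -sum1dep_card [RHS]big_mkcondr /=.
  by apply: eq_bigr => a _; rewrite subset_missed; case: (S \subset _).
rewrite dominating_missed add1n.
(* If [S] dominates, both sides are 1; otherwise the forest bound applies. *)
have [m0|mS] := eqVneq (missed S) set0; last exact: acyclic_card.
rewrite m0 cards0 addn0 ltnS leqn0 cards_eq0; apply/eqP/setP => a.
rewrite !inE subset0; apply/negP => /andP[/F2 a2 /eqP a0].
by rewrite a0 cards0 in a2.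
Qed.

End DominatingSets.

Lemma dom_ratio_ge (T : finType) (e : rel T) (k : nat) : (k <= #|T|)%N ->
  'C(#|T|, k)%:R - (dom_count e k)%:R
    <= (sigma e k - tau e k) * 'C(#|T|, k)%:R :> rat.
Proof.
move=> kn; have c_gt0 : 0 < 'C(#|T|, k)%:R :> rat by rewrite ltr0n bin_gt0.
suff : tau e k <= sigma e k - 1 + (dom_count e k)%:R / 'C(#|T|, k)%:R.
  by rewrite -(ler_pM2r c_gt0) mulrDl divfK ?gt_eqF // mulrBl mul1r mulrBl; lra.
have bound (F : {set {set T}}) : (forall a, a \in F -> #|a| = 2%N) -> acyclic F ->
    tree_weight e k F <= sigma e k - 1 + (dom_count e k)%:R / 'C(#|T|, k)%:R.
  move=> F2 acF; have := hunter_worsley_bound e k F2 acF.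
  rewrite -(ler_nat rat) !natrD !natr_sum => hunter.
  rewrite /tree_weight /sigma -!mulr_suml -(ler_pM2r c_gt0).
  by rewrite mulrDl mulrBl !divfK ?gt_eqF // mul1r; move: hunter; lra.
rewrite /tau; apply: bigmax_le => [|F /and3P[/forall_inP F2 _ acF]]; last first.
  by apply: bound => // a /F2/eqP.
(* The default value 0 of the maximum must obey the bound too; it is the weight of the empty forest,
   which is why [bound] covers all acyclic [F]. *)
rewrite -[0](_ : tree_weight e k set0 = 0); last by rewrite /tree_weight big_set0.
apply: bound => [a|]; first by rewrite inE.
apply/acyclicP => -[//|x p] /= _ /andP[+ _].
by case: p => [|y p] /= /andP[]; rewrite /edge_rel /= inE.
Qed.

Lemma coef_dom_poly (T : finType) (e : rel T) (j : nat) :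
  (dom_poly e)`_j = (dom_count e j)%:R.
Proof.
rewrite /dom_poly -(poly_def _ (fun j => (dom_count e j)%:R)) coef_poly.
case: ltnP => // nj; have := dom_count_le_bin e j.
by rewrite bin_small // leqn0 => /eqP->.
Qed.

Theorem theorem15 (T : finType) (e : rel T)
    (e_sym : symmetric e) (e_irr : irreflexive e) (n k : nat)
    (n_def : n = #|T|) (k_def : k = uphalf n)
    (hyp : sigma e k - tau e k
             <= (2%:R * k%:R + 1 - n%:R) / (k%:R + 1) :> rat) :
  unimodal_with_mode (dom_poly e) k.
Proof.
(* Yields [j.*2 < n] for every [j < k]. *)
have k2 : (k.*2 <= n.+1)%N by rewrite k_def; lia.
have kn : (k <= n)%N by rewrite k_def; lia.
split=> j; rewrite !coef_dom_poly ler_nat.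
  by move=> jk; apply: dom_count_le_incr; lia.
move=> kj _; apply: leq_trans (dom_count_le_bin e j.+1) _.
apply: bin_le_dom_count kj.
have k1_gt0 : 0 < k%:R + 1 :> rat by rewrite natr1 ltr0n.
have c_ge0 : 0 <= 'C(n, k)%:R :> rat by [].
(* The goal becomes [(n - k) * 'C(n, k) <= k.+1 * dom_count e k]; the constant in [hyp] fits because
   [(k + 1) - (2k + 1 - n) = n - k]. *)
rewrite -(leq_pmul2l (ltn0Sn k)) mul_bin_left -n_def -(ler_nat rat) !natrM.
rewrite natrB // -natr1.
have := dom_ratio_ge e (k := k); rewrite -n_def => /(_ kn) ratio.
have := le_trans ratio (ler_wpM2r c_ge0 hyp).
rewrite -(ler_pM2r k1_gt0) mulrAC divfK ?gt_eqF //.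
by set c := 'C(n, k)%:R; lra.
Qed.
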